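(* Let $\kappa$ be an infinite cardinal such that $\kappa=\kappa^{<\kappa}$. Then there exists a group $G$ of cardinality $\kappa$ with a descending principal series $$G=G_0\supset G_1\supset\cdots\supset G_n\supset\cdots$$ such that $\bigcap_{n<\omega}G_n=1$, and every non-trivial normal subgroup of $G$ is equal to $G_i$ for some $i<\omega$ and is isomorphic to $G$.
   Context: $\kappa^{<\kappa}$ denotes $\sup\{\kappa^{\lambda}:\lambda<\kappa \text{ a cardinal}\}$. A descending principal series of a group $G$ is a strictly descending chain $G=G_0\supset G_1\supset G_2\supset\cdots$ of normal subgroups of $G$ such that no normal subgroup of $G$ lies strictly between $G_{n+1}$ and $G_n$, for any $n<\omega$. *)

(* Defs.v *)
From HB Require Import structures.
From mathcomp Require Import all_boot.
From mathcomp Require Import boolp classical_sets functions cardinality.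

Set Implicit Arguments.
Unset Strict Implicit.
Unset Printing Implicit Defensive.

Local Open Scope classical_set_scope.
Local Open Scope card_scope.
Local Open Scope group_scope.

(* Cardinals are represented by types, compared through the cardinalities of
   their full sets; the power kappa^lambda is represented by L -> K. *)
Definition card_lt (L K : Type) : Prop :=
  [set: L] #<= [set: K] /\ ~ ([set: K] #<= [set: L]).

(* |M| is the supremum of the powers |K|^lambda over all cardinals
   lambda < |K|, i.e. |M| = |K|^{<|K|}.  There is no type of cardinals, so the
   supremum is stated as a least upper bound for #<=. *)
Definition is_weak_power (K M : Type) : Prop :=
  (forall L : Type, card_lt L K -> [set: L -> K] #<= [set: M]) /\
  (forall N : Type,
     (forall L : Type, card_lt L K -> [set: L -> K] #<= [set: N]) ->
     [set: M] #<= [set: N]).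

Definition normal_subgroup (G : groupType) (N : set G) : Prop :=
  group_closed [in N] /\ forall x y : G, N x -> N (x ^ y).

Definition descending_principal_series (G : groupType) (Gs : nat -> set G) :
    Prop :=
  [/\ Gs 0 = [set: G],
      forall n, normal_subgroup (Gs n),
      forall n, Gs n.+1 `<` Gs n &
      forall n, ~ exists N : set G,
        [/\ normal_subgroup N, Gs n.+1 `<` N & N `<` Gs n]].

(* The subset N, with the operation induced by H, is isomorphic to G. *)
Definition group_isomorphic (G H : groupType) (N : set H) : Prop :=
  exists f : {multiplicative G -> H}, set_bij [set: G] N f.

(* Main.v *)
Require Import Defs.
From HB Require Import structures.
From mathcomp Require Import all_boot.
From mathcomp Require Import boolp classical_sets functions cardinality.

(** The group is a group of permutations of the set W of sequences
    w : nat -> K.  A 3-cycle on the set of prefixes of length n acts on W by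
    changing the prefix and keeping the tail; let G_n (tower n) be generated by
    these 3-cycles for all lengths greater than n, and let G = G_0.

    A 3-cycle of length m > n conjugated by a permutation acting on prefixes of
    length n is again a 3-cycle of length m, so every G_n is normal in G, and
    every element of G is h * g with h acting on prefixes of length k and g in
    G_k (tower_factor).  An element of G_n fixes every sequence whose n-th entry
    avoids some finite set, because the prefixes moved by its factors have
    length greater than n and are finite in number.  Since K is infinite, only
    the identity of G_n acts on prefixes of length n (tower_local1); each
    element of G acts on prefixes of some length, so the G_n intersect in 1.

    Let N be normal in G and contain x in G_i but not in G_(i+1).  If x acts on
    prefixes of length m, then for each length k >= m the group N meets the
    finitary alternating group on prefixes of length k nontrivially, hence
    contains all its 3-cycles (normalized_all_cycles).  Smaller lengths follow
    by descent: once N contains G_(k+1), where k >= i, write x = h * g with h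
    acting on prefixes of length k+1 and g in G_(k+1).  Then h lies in N and is
    not 1, so N contains all 3-cycles of length k+1, that is, N contains G_k.
    Hence N contains G_i (normalized_tower), and every nontrivial normal
    subgroup is some G_i.

    Finally, a bijection K * K -> K lets one merge the first two entries of
    a sequence; conjugation by this bijection of W maps G_n onto G_(n+1)
    (tower_shift), whence the isomorphisms between G and the G_n.  The bijection
    comes from the inequality kappa^2 <= kappa contained in the hypothesis, and
    it also bounds the number of words in the 3-cycles by kappa. *)

Local Open Scope classical_set_scope.
Local Open Scope card_scope.

Set Implicit Arguments.
Unset Strict Implicit.
Unset Printing Implicit Defensive.

(** * The symmetric group of an arbitrary type *)

Record Sym (T : Type) := MkSym {
  sym_fun :> T -> T;
  sym_inv : T -> T;
  sym_funK : cancel sym_fun sym_inv;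
  sym_invK : cancel sym_inv sym_fun
}.

Section SymGroup.
Variable T : Type.
Implicit Types f g : Sym T.

Lemma symP f g : f =1 g -> f = g.
Proof.
case: f g => [f f' fK f'K] [g g' gK g'K] /= fg.
have {}fg : f = g by apply/funext.
have fg' : f' = g' by apply/funext=> x; rewrite -{1}(g'K x) -fg fK.
case: _ / fg in gK g'K *; case: _ / fg' in gK g'K *.
by congr MkSym; exact: Prop_irrelevance.
Qed.

Definition sym_one : Sym T := @MkSym T id id (fun=> erefl) (fun=> erefl).
Definition sym_mul f g : Sym T :=
  MkSym (can_comp (sym_funK f) (sym_funK g))
        (can_comp (sym_invK g) (sym_invK f)).
Definition sym_opp f : Sym T := MkSym (sym_invK f) (sym_funK f).

HB.instance Definition _ := gen_eqMixin (Sym T).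
HB.instance Definition _ := gen_choiceMixin (Sym T).

Lemma sym_mulA : associative sym_mul. Proof. by move=> f g h; exact: symP. Qed.
Lemma sym_mul1 : left_id sym_one sym_mul. Proof. by move=> f; exact: symP. Qed.
Lemma sym_mulr1 : right_id sym_one sym_mul. Proof. by move=> f; exact: symP. Qed.
Lemma sym_mulV : left_inverse sym_one sym_opp sym_mul.
Proof. by move=> f; apply: symP => x /=; exact: sym_funK. Qed.
Lemma sym_mulrV : right_inverse sym_one sym_opp sym_mul.
Proof. by move=> f; apply: symP => x /=; exact: sym_invK. Qed.

HB.instance Definition _ :=
  isGroup.Build (Sym T) sym_mulA sym_mul1 sym_mulr1 sym_mulV sym_mulrV.

Lemma sym1E x : (1%g : Sym T) x = x. Proof. by []. Qed.
Lemma symME f g x : (f * g)%g x = f (g x). Proof. by []. Qed.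
Lemma symVE f x : f^-1%g x = sym_inv f x. Proof. by []. Qed.
Lemma symKV f x : f (f^-1%g x) = x. Proof. exact: sym_invK. Qed.
Lemma symVK f x : f^-1%g (f x) = x. Proof. exact: sym_funK. Qed.
Lemma sym_inj f : injective f. Proof. exact: can_inj (sym_funK f). Qed.

End SymGroup.

(** * Permutations of sequences that act on prefixes *)
Section Tower.
Variable K : choiceType.
Local Notation W := (nat -> K).
Implicit Types (n m k i : nat) (a b c w x y z : W) (f g h : Sym W).

Definition glue n a w : W := fun i => if i < n then a i else w i.

Definition agree n w a : bool := `[< forall i, i < n -> w i = a i >].

Lemma agreeP n w a : reflect (forall i, i < n -> w i = a i) (agree n w a).
Proof. exact: asboolP. Qed.

Lemma agreexx n w : agree n w w. Proof. exact/agreeP. Qed.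
Hint Resolve agreexx : core.

Lemma agree_sym n w a : agree n w a = agree n a w.
Proof. by apply/idP/idP => /agreeP h; apply/agreeP=> i /h. Qed.

Lemma agree_trans n : transitive (agree n).
Proof. by move=> b a c /agreeP h /agreeP h'; apply/agreeP=> i ?; rewrite h ?h'. Qed.

Lemma agree_eql n a b w : agree n a b -> agree n a w = agree n b w.
Proof.
move=> ab; apply/idP/idP; apply: agree_trans => //.
by rewrite agree_sym.
Qed.

Lemma agree_eqr n a b w : agree n a b -> agree n w a = agree n w b.
Proof. by move=> ab; rewrite ![agree n w _]agree_sym; exact: agree_eql. Qed.

Lemma agree_glue n a w : agree n (glue n a w) a.
Proof. by apply/agreeP=> i; rewrite /glue => ->. Qed.

Lemma agree_glue_l n a w b : agree n (glue n a w) b = agree n a b.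
Proof. exact/agree_eql/agree_glue. Qed.

Lemma glue_agree n a w : agree n w a -> glue n a w = w.
Proof. by move/agreeP=> wa; apply/funext=> i; rewrite /glue; case: ifP => // /wa. Qed.

Lemma agreeE n w a : agree n w a <-> glue n a w = w.
Proof. by split; [exact: glue_agree | move=> <-; exact: agree_glue]. Qed.

Lemma glue_id n w : glue n w w = w. Proof. exact: glue_agree. Qed.

Lemma glue_glue n a b w : glue n a (glue n b w) = glue n a w.
Proof. by apply/funext=> i; rewrite /glue; case: (i < n). Qed.

Lemma glue_glue_l n a b w : glue n (glue n a b) w = glue n a w.
Proof. by apply/funext=> i; rewrite /glue; case: (i < n). Qed.

Lemma glue_eq n a b w : agree n a b -> glue n a w = glue n b w.
Proof. by move/agreeP=> ab; apply/funext=> i; rewrite /glue; case: ifP => // /ab. Qed.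

(** This single equation says both that f changes only the prefix of length n
    and that the new prefix depends only on the old one. *)
Definition local n f := forall a w, f (glue n a w) = glue n (f a) w.

Lemma local1 n : local n 1%g. Proof. by []. Qed.

Lemma localM n f g : local n f -> local n g -> local n (f * g)%g.
Proof. by move=> lf lg a w; rewrite !symME lg lf. Qed.

Lemma localV n f : local n f -> local n f^-1%g.
Proof.
by move=> lf a w; apply: (@sym_inj _ f); rewrite symKV lf symKV.
Qed.

Lemma local_tail n f w : local n f -> f w = glue n (f w) w.
Proof. by move=> lf; rewrite -lf glue_id. Qed.

Lemma local_leq n m f : n <= m -> local n f -> local m f.
Proof.
move=> nm lf a w.
have -> : glue m a w = glue n a (glue m a w).
  by apply/esym/glue_agree/agreeP=> i ni; rewrite /glue (leq_trans ni nm).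
rewrite lf (local_tail a lf); apply/funext=> i; rewrite /glue.
by case: (ltnP i n) => // ni; rewrite (leq_trans ni nm).
Qed.

Lemma local_agree n f a b : local n f -> agree n (f a) (f b) = agree n a b.
Proof.
suff sub g u v : local n g -> agree n u v -> agree n (g u) (g v).
  move=> lf; apply/idP/idP; last exact: sub.
  by move/(sub _ _ _ (localV lf)); rewrite !symVK.
by move=> lg /agreeE <-; rewrite lg agree_glue.
Qed.

Lemma local_ext n f g :
  local n f -> local n g -> (forall w, agree n (f w) (g w)) -> f = g.
Proof.
move=> lf lg fg; apply: symP => w.
by rewrite (local_tail w lf) (local_tail w lg); exact: glue_eq.
Qed.

Definition swap_fun n a b w : W :=
  if agree n w a then glue n b w else
  if agree n w b then glue n a w else w.

Lemma swap_funK n a b : involutive (swap_fun n a b).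
Proof.
move=> w; rewrite /swap_fun; case: (boolP (agree n w a)) => wa.
  rewrite !agree_glue_l agreexx !glue_glue (glue_agree wa); case: ifP => // ba.
  by apply: glue_agree; apply: agree_trans wa _; rewrite agree_sym.
case: (boolP (agree n w b)) => wb.
  by rewrite !agree_glue_l agreexx glue_glue glue_agree.
by rewrite (negbTE wa) (negbTE wb).
Qed.

Definition swap n a b : Sym W := MkSym (swap_funK n a b) (swap_funK n a b).

(** Where a, b, c have different prefixes, the commutator of two transpositions
    sharing a point is the 3-cycle a -> b -> c -> a; otherwise it is the
    identity, so the definition is total and needs no side condition. *)
Definition cycle3 n a b c : Sym W := [~ swap n a c, swap n b c]%g.

Lemma local_swap n a b : local n (swap n a b).
Proof.
move=> x w; rewrite /= /swap_fun !agree_glue_l.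
by case: ifP => _; [|case: ifP => _]; rewrite ?glue_glue ?glue_glue_l.
Qed.

Lemma local_cycle n a b c : local n (cycle3 n a b c).
Proof.
rewrite /cycle3 commgEl conjgE.
by do ![apply: localM|apply: localV|apply: local_swap].
Qed.

Lemma cycle3V n a b c : (cycle3 n a b c)^-1%g = cycle3 n b a c.
Proof. exact: invgR. Qed.

(** f maps the prefixes of length n to those of length m and the tails to the
    tails; the two lengths differ for the map merging two entries. *)
Definition intertwines n m f :=
  forall a w, f (glue n a w) = glue m (f a) (f w).

Lemma local_intertwines n f : local n f -> intertwines n n f.
Proof. by move=> lf a w; rewrite lf (local_tail w lf) glue_glue. Qed.

Lemma intertwinesV n m f : intertwines n m f -> intertwines m n f^-1%g.
Proof.
by move=> If a w; apply: (@sym_inj _ f); rewrite symKV If !symKV.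
Qed.

Lemma swapJ n m a b f : intertwines n m f ->
  (swap m a b ^ f)%g = swap n (f^-1%g a) (f^-1%g b).
Proof.
move=> If; apply: symP => w; rewrite conjgE !symME /= /swap_fun.
have agreef c : agree m (f w) c = agree n w (f^-1%g c).
  apply/idP/idP => /agreeE h; apply/agreeE.
    by apply: (@sym_inj _ f); rewrite If symKV.
  by rewrite -{1}(symKV f c) -If h.
have gluef c : f^-1%g (glue m c (f w)) = glue n (f^-1%g c) w.
  by apply: (@sym_inj _ f); rewrite If !symKV.
rewrite -!agreef.
by case: ifP => _; [|case: ifP => _]; rewrite -?symVE ?gluef ?symVK.
Qed.

Lemma cycle3J n m a b c f : intertwines n m f ->
  (cycle3 m a b c ^ f)%g = cycle3 n (f^-1%g a) (f^-1%g b) (f^-1%g c).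
Proof. by move=> If; rewrite /cycle3 conjRg !(swapJ _ _ If). Qed.

Lemma swap_eq n a b a' b' : agree n a a' -> agree n b b' ->
  swap n a b = swap n a' b'.
Proof.
move=> aa bb; apply: symP => w /=; rewrite /swap_fun.
by rewrite (agree_eqr _ aa) (agree_eqr _ bb) (glue_eq _ aa) (glue_eq _ bb).
Qed.

Lemma cycle3_eq n a b c a' b' c' :
  agree n a a' -> agree n b b' -> agree n c c' ->
  cycle3 n a b c = cycle3 n a' b' c'.
Proof. by move=> aa bb cc; rewrite /cycle3 (swap_eq aa cc) (swap_eq bb cc). Qed.

Lemma swap_left n a b w : agree n w a -> agree n (swap n a b w) b.
Proof. by move=> wa; rewrite /= /swap_fun wa agree_glue. Qed.

Lemma swap_right n a b w : agree n w b -> agree n (swap n a b w) a.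
Proof.
move=> wb; rewrite /= /swap_fun wb; case: ifP => [wa|_]; last exact: agree_glue.
by apply: agree_trans (agree_glue _ _ _) _; rewrite -(agree_eql _ wb).
Qed.

Lemma swap_out n a b w : ~~ agree n w a -> ~~ agree n w b -> swap n a b w = w.
Proof. by move=> /negbTE wa /negbTE wb; rewrite /= /swap_fun wa wb. Qed.

Lemma cycle3E n a b c w :
  cycle3 n a b c w =
  swap n a c (swap n b c (swap n a c (swap n b c w))).
Proof. by []. Qed.

Lemma cycle3_out n a b c w :
  ~~ agree n w a -> ~~ agree n w b -> ~~ agree n w c -> cycle3 n a b c w = w.
Proof. by move=> wa wb wc; rewrite cycle3E !swap_out. Qed.

Definition distinct3 n a b c :=
  [&& ~~ agree n a b, ~~ agree n a c & ~~ agree n b c].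

Lemma swap_other n a b d w : agree n w d -> ~~ agree n d a -> ~~ agree n d b ->
  agree n (swap n a b w) d.
Proof. by move=> wd da db; rewrite swap_out ?(agree_eql _ wd). Qed.

Lemma cycle3_1 n a b c w : distinct3 n a b c -> agree n w a ->
  agree n (cycle3 n a b c w) b.
Proof.
case/and3P=> ab ac bc wa; rewrite cycle3E.
apply: swap_other => //; first by apply/swap_right/swap_left/swap_other.
by rewrite agree_sym.
Qed.

Lemma cycle3_2 n a b c w : distinct3 n a b c -> agree n w b ->
  agree n (cycle3 n a b c w) c.
Proof.
case/and3P=> ab ac bc wb; rewrite cycle3E.
by apply/swap_left/swap_other => //; apply/swap_right/swap_left.
Qed.

Lemma cycle3_3 n a b c w : distinct3 n a b c -> agree n w c ->
  agree n (cycle3 n a b c w) a.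
Proof.
case/and3P=> ab ac bc wc; rewrite cycle3E.
apply/swap_right/swap_left/swap_other => //; first exact: swap_right.
by rewrite agree_sym.
Qed.


(** * The descending tower of groups *)

(** Multiplication by 3-cycles on one side suffices to generate a group, as the
    inverse of a 3-cycle is a 3-cycle. *)
Inductive tower n : Sym W -> Prop :=
| tower1 : tower n 1%g
| towerM m a b c g :
    n < m -> tower n g -> tower n (cycle3 m a b c * g)%g.

Lemma tower_cycle n m a b c : n < m -> tower n (cycle3 m a b c).
Proof. by move=> nm; rewrite -[cycle3 _ _ _ _]mulg1; apply: towerM (tower1 n). Qed.

Lemma tower_mul n f g : tower n f -> tower n g -> tower n (f * g)%g.
Proof.
move=> + tg; elim=> [|m a b c f' nm _ IH]; first by rewrite mul1g.
by rewrite -mulgA; exact: towerM.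
Qed.

Lemma tower_inv n f : tower n f -> tower n f^-1%g.
Proof.
elim=> [|m a b c f' nm _ IH]; first by rewrite invg1; exact: tower1.
by rewrite invgM cycle3V; apply: tower_mul => //; exact: tower_cycle.
Qed.

Lemma tower_leq n m f : n <= m -> tower m f -> tower n f.
Proof.
move=> nm; elim=> [|k a b c g mk _ IH]; first exact: tower1.
by apply: towerM => //; exact: leq_ltn_trans mk.
Qed.

Lemma tower_conj_local n f g : tower n f -> local n g -> tower n (f ^ g)%g.
Proof.
move=> + lg; elim=> [|m a b c f' nm _ IH]; first by rewrite conj1g; exact: tower1.
have /local_intertwines lmg := local_leq (ltnW nm) lg.
by rewrite conjMg (cycle3J _ _ _ lmg); exact: towerM.
Qed.

(** A generator of G has either length at most n, and then acts on prefixes of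
    length n, or length greater than n, and then belongs to G_n. *)
Lemma tower_conj n f g : tower n f -> tower 0 g -> tower n (f ^ g)%g.
Proof.
move=> + tg; elim: tg f => [|m a b c g' _ _ IH] f tf; first by rewrite conjg1.
rewrite conjgM; apply: IH; case: (leqP m n) => mn.
  by apply: tower_conj_local => //; exact/(local_leq mn)/local_cycle.
have tc := tower_cycle a b c mn.
by rewrite conjgE; apply: tower_mul (tower_inv tc) _; exact: tower_mul.
Qed.

Lemma tower_local n f : tower n f -> exists m, local m f.
Proof.
elim=> [|m a b c f' _ _ [k lk]]; first by exists 0; exact: local1.
exists (maxn m k); apply: localM.
  exact: local_leq (leq_maxl m k) (local_cycle _ _ _ _).
exact: local_leq (leq_maxr m k) lk.
Qed.

(** A 3-cycle of length greater than n moves only sequences that share their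
    n-th entry with one of its three points. *)
Lemma tower_fix n f :
  tower n f -> exists s : seq K, forall w, w n \notin s -> f w = w.
Proof.
elim=> [|m a b c f' nm _ [s fs]]; first by exists [::].
exists [:: a n, b n, c n & s] => w; rewrite !inE !negb_or.
case/and4P=> wa wb wc ws; rewrite symME fs //.
have out v : w n != v n -> ~~ agree m w v.
  by apply: contraNN => /agreeP ->.
by rewrite cycle3_out // out.
Qed.

(** Short generators are moved to the left past the long ones, which remain long
    3-cycles under the conjugation this causes. *)
Lemma tower_factor n k f : tower n f ->
  exists h g, [/\ tower n h, local k h, tower k g & f = (h * g)%g].
Proof.
elim=> [|m a b c f' nm _ [h [g [th lh tg ->]]]].
  exists 1%g, 1%g; split; [exact: tower1|exact: local1|exact: tower1|].
  by rewrite mulg1.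
case: (leqP m k) => mk.
  exists (cycle3 m a b c * h)%g, g; split => //; last by rewrite mulgA.
    exact: towerM.
  by apply: localM lh; exact/(local_leq mk)/local_cycle.
exists h, (cycle3 m a b c ^ h * g)%g; split => //.
  by apply: tower_mul => //; apply: tower_conj_local lh; exact: tower_cycle.
by rewrite mulgA (conjgC _ h) -mulgA.
Qed.

Section Infinite.
Hypothesis fresh_elt : forall s : seq K, exists u : K, u \notin s.

(** Changing the n-th entry of a sequence does not affect what f does to its
    prefix of length n, and some value of that entry makes f fix the sequence. *)
Lemma tower_local1 n f : tower n f -> local n f -> f = 1%g.
Proof.
move=> /tower_fix[s fs] lf; have [u us] := fresh_elt s.
apply: (local_ext lf (@local1 n)) => w.
pose w' : W := fun i => if i == n then u else w i.
have ww' : agree n w w'.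
  by apply/agreeP=> i lt_in; rewrite /w' ltn_eqF.
rewrite sym1E (agree_eqr _ ww') -(fs w') ?local_agree //.
by rewrite /w' eqxx.
Qed.

Lemma fresh_point n (s : seq W) : 0 < n ->
  exists w, all (fun v => ~~ agree n w v) s.
Proof.
move=> n0; have [u us] := fresh_elt [seq v 0 | v : W <- s].
exists (fun=> u); apply/allP=> v vs; apply: contra us => /agreeP /(_ 0 n0) ->.
exact: map_f.
Qed.

(** * Normal subgroups contain 3-cycles *)
Definition normalized (N : Sym W -> Prop) :=
  [/\ forall f g, N f -> N g -> N (f * g)%g, forall f, N f -> N f^-1%g &
      forall f g, N f -> tower 0 g -> N (f ^ g)%g].

Section Normal.
Variable N : Sym W -> Prop.
Hypothesis nN : normalized N.

Variable n : nat.
Hypothesis n0 : 0 < n.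

(** The product is the commutator of h^-1 and an inverse 3-cycle. *)
Lemma normalized_commutator h a b c : N h -> local n h ->
  N (cycle3 n (h a) (h b) (h c) * cycle3 n b a c)%g.
Proof.
case: nN => NM NV NJ Nh lh; set t := cycle3 n a b c.
have th : tower 0 t by exact: tower_cycle.
have -> : (cycle3 n (h a) (h b) (h c) * cycle3 n b a c = h * h^-1 ^ t^-1)%g.
  have := cycle3J a b c (local_intertwines (localV lh)).
  by rewrite invgK => <-; rewrite -(cycle3V n a b c) !conjgE !invgK !mulgA.
by apply: NM => //; apply: NJ; [exact: NV|exact: tower_inv].
Qed.

(** The commutator d of h with a 3-cycle through a point moved by h is
    nontrivial and moves finitely many prefixes; the commutator of d with a
    3-cycle through one point moved and two points fixed by d is a 3-cycle. *)
Lemma normalized_has_cycle h : N h -> local n h -> h <> 1%g ->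
  exists a b c, distinct3 n a b c /\ N (cycle3 n a b c).
Proof.
move=> Nh lh h1.
have [a ha] : exists a, ~~ agree n (h a) a.
  apply: contrapT => hfix; apply: h1; apply: local_ext lh (@local1 n) _ => w.
  by apply: contrapT => /negP hw; apply: hfix; exists w.
(* d sends h a to h y, since y and z differ from h a. *)
have [y] := fresh_point [:: a; h a] n0; rewrite /= andbT => /andP[ya yha].
have [z] := fresh_point [:: a; h a; y] n0.
rewrite /= andbT => /and3P[za zha zy].
have := normalized_commutator a y z Nh lh; set d := (_ * _)%g => Nd.
have ld : local n d by apply: localM; exact: local_cycle.
have dh : distinct3 n (h a) (h y) (h z).
  rewrite /distinct3 !local_agree // [agree n a y]agree_sym.
  by rewrite [agree n a z]agree_sym [agree n y z]agree_sym ya za.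
have da : agree n (d (h a)) (h y).
  rewrite /d symME [cycle3 n y a z _]cycle3_out //; first exact: cycle3_1.
  - by rewrite agree_sym.
  - by rewrite agree_sym.
(* Two prefixes fixed by d. *)
have [y'] := fresh_point [:: a; y; z; h a; h y; h z] n0.
rewrite /= andbT => /and5P[y1 y2 y3 y4 /andP[y5 y6]].
have [z'] := fresh_point [:: a; y; z; h a; h y; h z; y'] n0.
rewrite /= andbT => /and5P[z1 z2 z3 z4 /and3P[z5 z6 z7]].
have dy' : d y' = y' by rewrite /d symME [cycle3 n y a z y']cycle3_out // cycle3_out.
have dz' : d z' = z' by rewrite /d symME [cycle3 n y a z z']cycle3_out // cycle3_out.
have := normalized_commutator (h a) y' z' Nd ld; rewrite dy' dz' => N2.
exists y', (h a), (h y).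
have dis : distinct3 n y' (h a) (h y).
  by case/and3P: dh => h1' _ _; apply/and3P; split.
split => //.
suff -> : cycle3 n y' (h a) (h y) =
  (cycle3 n (d (h a)) y' z' * cycle3 n y' (h a) z')%g by [].
rewrite (cycle3_eq da (agreexx n y') (agreexx n z')).
have D1 : distinct3 n (h y) y' z'.
  by rewrite /distinct3 ![agree n (h y) _]agree_sym [agree n y' z']agree_sym y5 z5 z7.
have D2 : distinct3 n y' (h a) z'.
  by rewrite /distinct3 y4 ![agree n _ z']agree_sym z7 z4.
(* Both sides map y' to h a, then to h y and back to y'. *)
apply: local_ext => [||w]; first exact: local_cycle.
  by apply: localM; exact: local_cycle.
rewrite symME.
have [wz|wz] := boolP (agree n w z').
  rewrite cycle3_out ?(agree_eql _ wz) // agree_sym.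
  by apply: cycle3_2 D1 _; exact: cycle3_3 D2 _.
have [wy|wy] := boolP (agree n w y').
  rewrite (agree_eql _ (cycle3_1 dis wy)) agree_sym.
  have c1 := cycle3_1 D2 wy.
  rewrite cycle3_out ?(agree_eql _ c1) ?agreexx //; first by case/and3P: dh.
  - by rewrite agree_sym.
  - by rewrite agree_sym.
have [wa|wa] := boolP (agree n w (h a)).
  rewrite (agree_eql _ (cycle3_2 dis wa)) agree_sym.
  by apply: cycle3_3 D1 _; exact: cycle3_2 D2 _.
rewrite [cycle3 n y' (h a) z' w]cycle3_out //.
have [wh|wh] := boolP (agree n w (h y)); last by rewrite !cycle3_out.
rewrite (agree_eql _ (cycle3_3 dis wh)) agree_sym.
exact: cycle3_1 D1 wh.
Qed.

Lemma normalized_cycleJ p q r a b c : N (cycle3 n a b c) ->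
  N (cycle3 n (cycle3 n p q r a) (cycle3 n p q r b) (cycle3 n p q r c)).
Proof.
case: nN => _ _ NJ Nabc.
have lt := local_intertwines (localV (local_cycle n p q r)).
have := NJ _ _ Nabc (tower_inv (tower_cycle p q r n0)).
by rewrite (cycle3J _ _ _ lt) invgK.
Qed.

Lemma normalized_rotate a b c :
  distinct3 n a b c -> N (cycle3 n a b c) -> N (cycle3 n b c a).
Proof.
move=> dis /(normalized_cycleJ a b c).
by rewrite (cycle3_eq (cycle3_1 dis _) (cycle3_2 dis _) (cycle3_3 dis _)).
Qed.

(** Conjugation by the 3-cycle c -> x -> z, where z is a new point. *)
Lemma normalized_replace3 a b c x : distinct3 n a b c ->
  ~~ agree n x a -> ~~ agree n x b ->
  N (cycle3 n a b c) -> N (cycle3 n a b x).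
Proof.
move=> dis xa xb Nabc.
have [xc|xc] := boolP (agree n x c).
  by rewrite (cycle3_eq (agreexx n a) (agreexx n b) xc).
have [z] := fresh_point [:: a; b; c; x] n0.
rewrite /= andbT => /and4P[za zb zc zx].
have [ab ac bc] := and3P dis.
have dis' : distinct3 n c x z.
  rewrite /distinct3 [agree n c x]agree_sym xc [agree n c z]agree_sym zc.
  by rewrite agree_sym.
have fixed v : agree n v a || agree n v b -> cycle3 n c x z v = v.
  by case/orP=> vv; apply: cycle3_out; rewrite (agree_eql _ vv) // agree_sym.
have := normalized_cycleJ c x z Nabc.
rewrite fixed ?agreexx // fixed ?agreexx ?orbT //.
by rewrite (cycle3_eq (agreexx n a) (agreexx n b) (cycle3_1 dis' (agreexx n c))).
Qed.

Lemma cycle3_degenerate a b c : ~~ distinct3 n a b c -> cycle3 n a b c = 1%g.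
Proof.
have swap_same x y : agree n x y -> swap n x y = 1%g.
  move=> xy; apply: symP => w /=; rewrite /swap_fun (agree_eqr _ xy).
  by case wy: (agree n w y) => //; exact: glue_agree.
rewrite /distinct3 /cycle3 -!negb_or negbK => /or3P[ab|ac|bc].
- by rewrite (swap_eq ab (agreexx n c)) commgg.
- by rewrite (swap_same a c) // comm1g.
- by rewrite (swap_same b c) // commg1.
Qed.

(** The given 3-cycle and the wanted one may share points; both are linked to a
    3-cycle on three new points x, y, z by rotations and replacements of the
    last entry. *)
Lemma normalized_all_cycles h : N h -> local n h -> h <> 1%g ->
  forall a b c, N (cycle3 n a b c).
Proof.
move=> Nh lh h1 a' b' c'; have [a [b [c [dis Nabc]]]] := normalized_has_cycle Nh lh h1.
case: (boolP (distinct3 n a' b' c')) => [dis'|/cycle3_degenerate->]; last first.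
  by case: nN => NM NV _; rewrite -(mulgV h); exact/NM/NV.
have [x] := fresh_point [:: a; b; c; a'; b'; c'] n0.
rewrite /= andbT => /and5P[xa xb xc xa' /andP[xb' xc']].
have [y] := fresh_point [:: a; b; c; a'; b'; c'; x] n0.
rewrite /= andbT => /and5P[ya yb yc ya' /and3P[yb' yc' yx]].
have [z] := fresh_point [:: a; b; c; a'; b'; c'; x; y] n0.
rewrite /= andbT => /and5P[za zb zc za' /and4P[zb' zc' zx zy]].
have [ab ac bc] := and3P dis; have [ab' ac' bc'] := and3P dis'.
have dis3 u v w : ~~ agree n v u -> ~~ agree n w u -> ~~ agree n w v ->
    distinct3 n u v w.
  by move=> vu wu wv; rewrite /distinct3 agree_sym vu agree_sym wu agree_sym.
have ba' : ~~ agree n b' a' by rewrite agree_sym.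
have ca' : ~~ agree n c' a' by rewrite agree_sym.
have cb' : ~~ agree n c' b' by rewrite agree_sym.
have swp u v : ~~ agree n v u -> ~~ agree n u v by rewrite agree_sym.
move: (normalized_replace3 dis xa xb Nabc).
move/(normalized_rotate (dis3 _ _ _ (swp _ _ ab) xa xb)).
move/(normalized_replace3 (dis3 _ _ _ xb ab (swp _ _ xa)) yb yx).
move/(normalized_rotate (dis3 _ _ _ xb yb yx)).
move/(normalized_replace3 (dis3 _ _ _ yx (swp _ _ xb) (swp _ _ yb)) zx zy).
move/(normalized_replace3 (dis3 _ _ _ yx zx zy) (swp _ _ xa') (swp _ _ ya')).
move/(normalized_rotate (dis3 _ _ _ yx (swp _ _ xa') (swp _ _ ya'))).
move/(normalized_replace3 (dis3 _ _ _ (swp _ _ ya') (swp _ _ yx) xa')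
       (swp _ _ yb') ba').
move/(normalized_rotate (dis3 _ _ _ (swp _ _ ya') (swp _ _ yb') ba')).
by move/(normalized_replace3 (dis3 _ _ _ ba' ya' yb') ca' cb').
Qed.

End Normal.

(** The descent on the length of prefixes: high treats the lengths at which f
    itself acts, low the smaller ones by induction on the distance d. *)
Lemma normalized_tower (N : Sym W -> Prop) n f : normalized N ->
  N f -> tower n f -> ~ tower n.+1 f -> forall g, tower n g -> N g.
Proof.
move=> nN Nf tf ntf; have [NM NV NJ] := nN.
have N1 : N 1%g by rewrite -(mulgV f); exact/NM/NV.
have f1 : f <> 1%g by move=> f1; apply: ntf; rewrite f1; exact: tower1.
have [m lf] := tower_local tf.
have high k g : m <= k -> tower k g -> N g.
  move=> mk; elim=> // p a b c g' kp _ Ng'; apply: NM Ng'.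
  have lfp := local_leq (leq_trans mk (ltnW kp)) lf.
  exact: normalized_all_cycles nN _ (leq_ltn_trans (leq0n k) kp) _ Nf lfp f1 _ _ _.
suff low d k g : n <= k -> m <= k + d -> tower k g -> N g.
  by move=> g; apply: (low m) => //; exact: leq_addl.
elim: d k g => [|d IH] k g nk; first by rewrite addn0; exact: high.
rewrite addnS -addSn => mkd; have Nk := IH k.+1 _ (leqW nk) mkd.
have [h [g' [_ lh tg' fE]]] := tower_factor k.+1 tf.
have Nh : N h.
  by rewrite -(mulgK g' h) -fE; apply: NM => //; apply: NV; exact: Nk.
have h1 : h <> 1%g.
  by move=> h1; apply: ntf; apply: tower_leq (_ : n.+1 <= k.+1) _ => //; rewrite fE h1 mul1g.
elim=> // p a b c g'' kp _; apply: NM.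
case: (ltngtP p k.+1) kp => // [kp|->] _; first exact/Nk/tower_cycle.
exact: normalized_all_cycles Nh lh h1 _ _ _.
Qed.

Lemma tower_proper n : exists2 f, tower n f & ~ tower n.+1 f.
Proof.
have [a _] := @fresh_point n.+1 [::] isT.
have [b] := @fresh_point n.+1 [:: a] isT; rewrite /= andbT => ba.
have [c] := @fresh_point n.+1 [:: a; b] isT; rewrite /= andbT => /andP[ca cb].
exists (cycle3 n.+1 a b c); first exact: tower_cycle.
move/tower_local1 => /(_ (local_cycle _ _ _ _)) c1.
have dis : distinct3 n.+1 a b c.
  by rewrite /distinct3 agree_sym ba agree_sym ca agree_sym.
by have := cycle3_1 dis (agreexx _ a); rewrite c1 sym1E agree_sym (negbTE ba).
Qed.

End Infinite.

(** * Merging the first two entries *)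
Section Shift.
Variables (pairing : K * K -> K) (unpairing : K -> K * K).
Hypotheses (pairingK : cancel pairing unpairing) (unpairingK : cancel unpairing pairing).

Definition merge w : W := fun i => if i is j.+1 then w j.+2 else pairing (w 0, w 1).
Definition unmerge w : W := fun i =>
  match i with
  | 0 => (unpairing (w 0)).1
  | 1 => (unpairing (w 0)).2
  | j.+2 => w j.+1
  end.

Lemma mergeK : cancel merge unmerge.
Proof. by move=> w; apply/funext=> -[|[|i]] //=; rewrite pairingK. Qed.

Lemma unmergeK : cancel unmerge merge.
Proof. by move=> w; apply/funext=> -[|i] //=; rewrite -surjective_pairing unpairingK. Qed.

Definition shift : Sym W := MkSym mergeK unmergeK.

Lemma shift_intertwines n : intertwines n.+2 n.+1 shift.
Proof. by move=> a w; apply/funext=> -[|i]. Qed.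

Lemma tower_shift n f : tower n.+1 (f ^ shift)%g <-> tower n f.
Proof.
split=> [|tf]; last first.
  elim: tf => [|[//|m] a b c g nm _ IH]; first by rewrite conj1g; exact: tower1.
  by rewrite conjMg (cycle3J _ _ _ (shift_intertwines m)); exact: towerM.
rewrite -{2}(conjgK shift f).
elim=> [|[//|[//|m]] a b c g nm _ IH]; first by rewrite conj1g; exact: tower1.
rewrite conjMg (cycle3J _ _ _ (intertwinesV (shift_intertwines m))).
exact: towerM.
Qed.

Lemma tower_shiftX n f : tower n (f ^ (shift ^+ n))%g <-> tower 0 f.
Proof.
elim: n => [|n IH]; first by rewrite expg0 conjg1.
by rewrite expgSr conjgM -IH; exact: tower_shift.
Qed.

End Shift.
End Tower.

(** * The group and its normal subgroups *)
Section TowerGroup.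
Variable K : choiceType.
Local Notation W := (nat -> K).
Local Notation S := (Sym W).

Record tower_group := TowerGroup {
  tower_val : S;
  tower_valP : `[< tower 0 tower_val >]
}.

HB.instance Definition _ := [isSub for tower_val].
HB.instance Definition _ := [Choice of tower_group by <:].

Lemma tower_group_closed : group_closed (fun f : S => `[< tower 0 f >]).
Proof.
split=> [|f g]; first exact/asboolP/tower1.
move=> /asboolP tf /asboolP tg; apply/asboolP.
exact/tower_mul/tower_inv.
Qed.

HB.instance Definition _ :=
  SubChoice_isSubGroup.Build S _ tower_group tower_group_closed.

Implicit Types g h : tower_group.

Lemma tower_group_tower g : tower 0 (val g).
Proof. exact/asboolP/tower_valP. Qed.

Definition level (n : nat) : set tower_group := [set g | tower n (val g)].

Lemma normal_level n : normal_subgroup (level n).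
Proof.
split; last by move=> g h lg; apply: tower_conj => //; exact: tower_group_tower.
split=> [|g h]; first exact/mem_set/tower1.
move=> /set_mem lg /set_mem lh; apply: mem_set; exact/tower_mul/tower_inv.
Qed.

Lemma level0 : level 0 = [set: tower_group].
Proof. by apply/seteqP; split=> // g _; exact: tower_group_tower. Qed.

Lemma level_leq n m : n <= m -> level m `<=` level n.
Proof. by move=> nm g; exact: tower_leq. Qed.

Lemma normalized_normal (N : set tower_group) : normal_subgroup N ->
  normalized (fun f : S => exists2 g, N g & val g = f).
Proof.
move=> [grpN NJ]; split.
- move=> _ _ [g Ng <-] [h Nh <-]; exists (g * h)%g => //; apply: set_mem.
  by apply: (group_closedM grpN); apply: mem_set.
- move=> _ [g Ng <-]; exists (g^-1)%g => //; apply: set_mem.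
  by apply: (group_closedV grpN); apply: mem_set.
- move=> _ f [g Ng <-] tf; exists (g ^ (TowerGroup (asboolT tf)))%g => //.
  exact: NJ.
Qed.

Section Infinite.
Hypothesis fresh_elt : forall s : seq K, exists u : K, u \notin s.

Lemma level_sub_normal (N : set tower_group) n g : normal_subgroup N ->
  N g -> level n g -> ~ level n.+1 g -> level n `<=` N.
Proof.
move=> nN Ng lg nlg h lh.
have [] := normalized_tower fresh_elt (normalized_normal nN) _ lg nlg lh.
  by exists g.
by move=> h' Nh' /val_inj <-.
Qed.

Lemma bigcap_level : \bigcap_(n in [set: nat]) level n = [set 1%g].
Proof.
apply/seteqP; split=> [g lg|_ -> n _]; last exact: tower1.
have [m lm] := tower_local (tower_group_tower g).
by apply: val_inj; apply: tower_local1 fresh_elt _ _ _ lm; exact: lg.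
Qed.

(** A normal subgroup inside level n but not inside level n.+1 contains level n,
    so nothing lies strictly between the two. *)
Lemma level_series : descending_principal_series level.
Proof.
split; [exact: level0 | exact: normal_level | |] => n.
  split=> [|sub]; first exact/level_leq/leqnSn.
  have [f tf ntf] := tower_proper fresh_elt n.
  have t0 : `[< tower 0 f >] by apply/asboolP/(tower_leq (leq0n n)).
  by apply: ntf; exact: (sub (TowerGroup t0)).
case=> N [nN [_ notsub] [subn nsub]]; apply: notsub => g Ng.
apply: contrapT => nlg; apply: nsub.
exact: level_sub_normal nN Ng (subn _ Ng) nlg.
Qed.

(** The index i is the least one such that N is not inside level i.+1. *)
Lemma normal_is_level (N : set tower_group) : normal_subgroup N ->
  N <> [set 1%g] -> exists i, N = level i.
Proof.
move=> nN N1.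
have [grpN _] := nN.
have exN : exists i, `[< exists2 g, N g & ~ level i.+1 g >].
  apply: contrapT => noN; apply: N1; apply/seteqP; split=> [g Ng|_ ->].
    rewrite -bigcap_level => n _; apply: contrapT => nlg; apply: noN.
    exists n; apply/asboolP; exists g => // lg.
    exact/nlg/(level_leq (leqnSn n)).
  exact/set_mem/(proj1 grpN).
case: (ex_minnP exN) => i /asboolP[g Ng nlg] imin.
have subN : N `<=` level i.
  case: i imin {nlg} => [|i] imin; first by rewrite level0.
  move=> h Nh; apply: contrapT => nlh.
  have /imin : `[< exists2 g, N g & ~ level i.+1 g >] by apply/asboolP; exists h.
  by rewrite ltnn.
exists i; apply/seteqP; split=> //.
exact: level_sub_normal nN Ng (subN _ Ng) nlg.
Qed.

End Infinite.

Lemma level_isomorphic (pairing : K * K -> K) n :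
  bijective pairing -> group_isomorphic tower_group (level n).
Proof.
case=> unpairing pairingK unpairingK; pose s := (shift pairingK unpairingK ^+ n)%g.
have ts f : tower n (f ^ s)%g <-> tower 0 f := tower_shiftX pairingK unpairingK n f.
have t0 f : tower 0 f -> tower 0 (f ^ s)%g.
  by move=> tf; apply: (tower_leq (leq0n n)); exact/ts.
pose phi g := TowerGroup (asboolT (t0 _ (tower_group_tower g))).
have phiM : {morph phi : g h / (g * h)%g}.
  by move=> g h; apply: val_inj; rewrite /= conjMg.
pose phi_mul := isMultiplicative.Build tower_group tower_group phi phiM.
exists (HB.pack_for {multiplicative tower_group -> tower_group} phi phi_mul); split=> /=.
- by move=> g _; apply/ts; exact: tower_group_tower.
- by move=> g h _ _ /(congr1 val)/conjg_inj/val_inj.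
move=> g lg; have tg : tower 0 (val g ^ s^-1)%g by apply/ts; rewrite conjgKV.
exists (TowerGroup (asboolT tg)) => //; apply: val_inj.
by rewrite /= conjgKV.
Qed.

End TowerGroup.

(** * Cardinality *)
Section Cardinality.

Lemma inj_card_leT (T U : Type) (f : T -> U) :
  injective f -> [set: T] #<= [set: U].
Proof.
move=> finj; apply/card_leP/injfunPex.
exists (fun x => SigSub (mem_set (I : [set: U] (f (val x))))) => //.
by move=> x y _ _ /(congr1 val) /= /finj/val_inj.
Qed.

Lemma card_leT_inj (T U : Type) :
  [set: T] #<= [set: U] -> exists f : T -> U, injective f.
Proof.
move=> /card_leP/injfunPex[f _ finj].
exists (fun t => val (f (SigSub (mem_set (I : [set: T] t))))) => x y /val_inj.
by move=> /finj; rewrite !in_setT => /(_ isT isT) /(congr1 val).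
Qed.

Lemma card_eqT_bij (T U : Type) :
  [set: T] #= [set: U] -> exists f : T -> U, bijective f.
Proof.
move=> /card_bijP[f [g fK gK]].
pose inT x : [set: T] := SigSub (mem_set (I : [set: T] x)).
pose inU y : [set: U] := SigSub (mem_set (I : [set: U] y)).
have inTK (x : [set: T]) : inT (val x) = x by exact: val_inj.
have inUK (y : [set: U]) : inU (val y) = y by exact: val_inj.
exists (fun x => val (f (inT x))), (fun y => val (g (inU y))) => [x|y].
  by rewrite inUK fK.
by rewrite inTK gK.
Qed.

Variable K : choiceType.
Local Notation W := (nat -> K).
Variables (pairing : K * K -> K) (elt : nat -> K).
Hypotheses (pairing_inj : injective pairing) (elt_inj : injective elt).

Lemma infinite_fresh (s : seq K) : exists u : K, u \notin s.
Proof.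
apply: contrapT => nfresh.
have sub : {subset [seq elt i | i <- iota 0 (size s).+1] <= s}.
  by move=> u _; apply: contrapT => /negP us; apply: nfresh; exists u.
have := uniq_leq_size _ sub; rewrite map_inj_uniq ?iota_uniq // => /(_ isT).
by rewrite size_map size_iota ltnn.
Qed.

(** The length is recorded because the nested pairs alone do not determine where
    the sequence ends. *)
Definition encode_seq (s : seq K) : K :=
  pairing (elt (size s), foldr (fun x y => pairing (x, y)) (elt 0) s).

Lemma encode_seq_inj : injective encode_seq.
Proof.
move=> s t /pairing_inj[/elt_inj].
elim: s t => [|x s IH] [|y t] //= [st] /pairing_inj[-> fst].
by rewrite (IH t).
Qed.

Definition encode_gen (g : nat * (seq K * (seq K * seq K))) : K :=
  let: (m, (a, (b, c))) := g in
  pairing (elt m, pairing (encode_seq a, pairing (encode_seq b, encode_seq c))).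

Lemma encode_gen_inj : injective encode_gen.
Proof.
move=> [m [a [b c]]] [m' [a' [b' c']]] /pairing_inj[/elt_inj->].
move=> /pairing_inj[/encode_seq_inj->].
by move=> /pairing_inj[/encode_seq_inj-> /encode_seq_inj->].
Qed.

Definition point_of (s : seq K) : W := nth (elt 0) s.

Definition eval_word (l : seq (nat * (seq K * (seq K * seq K)))) : Sym W :=
  foldr (fun g f => let: (m, (a, (b, c))) := g in
    cycle3 m (point_of a) (point_of b) (point_of c) * f)%g 1%g l.

(** A 3-cycle of length m depends only on the prefixes of length m of its three
    points, so elements of the tower are described by finite words over K. *)
Lemma eval_surj n f : tower n f -> exists l, eval_word l = f.
Proof.
elim=> [|m a b c f' _ _ [l <-]]; first by exists [::].
have prefix w : agree m (point_of (mkseq w m)) w.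
  by apply/agreeP=> i im; rewrite /point_of nth_mkseq.
exists ((m, (mkseq a m, (mkseq b m, mkseq c m))) :: l) => /=.
by rewrite (cycle3_eq (prefix a) (prefix b) (prefix c)).
Qed.

Lemma card_tower_group_le : [set: tower_group K] #<= [set: K].
Proof.
have /choice[word wordP] (g : tower_group K) : exists l, eval_word l = val g.
  exact: eval_surj (tower_group_tower g).
apply: (inj_card_leT (f := fun g => encode_seq (map encode_gen (word g)))).
move=> g h /encode_seq_inj/(inj_map encode_gen_inj) gh.
by apply: val_inj; rewrite -!wordP gh.
Qed.

(** The 3-cycles of length 2 on the points (k, elt 0), (k, elt 1), (k, elt 2) are
    disjoint for different k. *)
Lemma card_tower_group_ge : [set: K] #<= [set: tower_group K].
Proof.
pose pt k u : W := fun i => if i is 0 then k else elt u.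
pose f k := cycle3 2 (pt k 0) (pt k 1) (pt k 2).
have diff k u v : u <> v -> ~~ agree 2 (pt k u) (pt k v).
  by move=> uv; apply/agreeP => /(_ 1 isT) /elt_inj.
have dis k : distinct3 2 (pt k 0) (pt k 1) (pt k 2).
  by apply/and3P; split; exact: diff.
have t0 k : tower 0 (f k) by exact: tower_cycle.
apply: (inj_card_leT (f := fun k => TowerGroup (asboolT (t0 k)))).
move=> k k' /(congr1 val) /= fkk'; apply: contrapT => kk'.
have out u v : ~~ agree 2 (pt k u) (pt k' v).
  by apply/agreeP => /(_ 0 isT).
have := cycle3_1 (dis k) (agreexx 2 (pt k 0)).
by rewrite -/(f k) fkk' cycle3_out //; apply/negP; exact: diff.
Qed.

Lemma card_tower_group : [set: tower_group K] #= [set: K].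
Proof.
exact: Cantor_Bernstein card_tower_group_le card_tower_group_ge.
Qed.

End Cardinality.

Lemma card_lt_bool (K : Type) : infinite_set [set: K] -> card_lt bool K.
Proof.
move=> Kinf; split; last first.
  by move=> Kb; apply: Kinf; exact: card_le_finite Kb finite_finset.
apply: card_le_trans (_ : [set: nat] #<= _); last exact/infiniteP.
by apply: (inj_card_leT (f := nat_of_bool)) => -[] [].
Qed.

Theorem mainTheorem1 (K : Type) (K_infinite : infinite_set [set: K])
    (K_weak_power : is_weak_power K K) :
  exists (G : groupType) (Gs : nat -> set G),
    [/\ [set: G] #= [set: K],
        descending_principal_series Gs,
        \bigcap_(n in [set: nat]) Gs n = [set 1%g] &
        forall N : set G, normal_subgroup N -> N <> [set 1%g] ->
          (exists i : nat, N = Gs i) /\ group_isomorphic G N].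
Proof.
have [elt elt_inj] := card_leT_inj ((infiniteP _).1 K_infinite).
have [pow pow_inj] := card_leT_inj (K_weak_power.1 _ (card_lt_bool K_infinite)).
pose pr (u : K * K) := pow (fun b => if b then u.1 else u.2).
have pr_inj : injective pr.
  move=> [x y] [x' y'] /pow_inj /= e.
  by have := congr1 (@^~ true) e; have := congr1 (@^~ false) e => /= -> ->.
have KK : [set: K * K] #= [set: K].
  apply: Cantor_Bernstein; first exact: inj_card_leT pr_inj.
  by apply: (inj_card_leT (f := fun x => (x, x))) => x y [].
have [pairing pairing_bij] := card_eqT_bij KK.
have fresh := @infinite_fresh {classic K} _ elt_inj.
exists (tower_group {classic K}), (@level {classic K}); split.
- exact: (card_tower_group (K := {classic K}) pr_inj elt_inj).
- exact: level_series fresh.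
- exact: bigcap_level fresh.
move=> N nN N1; have [i ->] := normal_is_level fresh nN N1.
split; first by exists i.
exact: (level_isomorphic (K := {classic K}) i pairing_bij).
Qed.
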